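(* Let $A\subset\mathbb{C}\setminus\{0\}$ be finite with $|A|=n$, and write $1/A:=\{1/a:a\in A\}$, $X+Y:=\{x+y:x\in X,y\in Y\}$. Then $$\max\{|A+A|,|1/A+1/A|\}=\Omega(n^{5/4})\quad\text{and}\quad |A+1/A|=\Omega(n^{5/4}),$$ with absolute implied constants. *)

(* Defs.v *)
From Stdlib Require Import Reals List.
Import ListNotations.
Open Scope R_scope.

Definition Cx : Type := (R * R)%type.
Definition C0 : Cx := (0, 0).
Definition Cadd (z w : Cx) : Cx := (fst z + fst w, snd z + snd w).
Definition Cinv (z : Cx) : Cx :=
  (fst z / (fst z * fst z + snd z * snd z),
   - snd z / (fst z * fst z + snd z * snd z)).

(* A finite subset of Cx is given by a duplicate-free list. *)
Definition invset (A : list Cx) : list Cx := map Cinv A.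

Definition sumset (X Y : list Cx) (z : Cx) : Prop :=
  exists x y, In x X /\ In y Y /\ z = Cadd x y.

Definition card_is (P : Cx -> Prop) (m : nat) : Prop :=
  exists l : list Cx, NoDup l /\ (forall z, In z l <-> P z) /\ length l = m.

(* Main.v *)
(* Solymosi's nearest-neighbour method.  Let a' be the point of A nearest to a.

   If |a - a'| <= |a|/2 for at least half of the points, the map
   (a, b, c) |-> (a + b, a' + b, 1/a + c, 1/a' + c) is at most 2-to-1.  A point
   lies in boundedly many discs B(a, |a - a'|), so for most triples only
   O(|S1|/n) elements of the first sumset S1 are closer to a + b than a' + b
   (within a narrow cone), and similarly for the second sumset S2, with the
   cone taken at 1/a' + c.  Given one member of each pair, the other one has
   therefore O(|S|/n) possible values, and n^3 = O(|S1|^2 |S2|^2 / n^2).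

   Otherwise at least half of the points are isolated at their own scale, so
   that every annulus contains boundedly many of them; a sum x + y with |x| at
   least twice |y| then determines x up to O(1) choices, and the sumsets
   have quadratic size. *)
From Stdlib Require Import Reals List Lra.
From mathcomp Require Import all_boot zify boolp Rstruct.
From Coquelicot Require Import Coquelicot.
Require Import Defs.
Set Implicit Arguments.
Unset Strict Implicit.
Open Scope R_scope.

(** * Sectors of the plane and distances inside them *)

(* Cutting at the axes and at the slopes 1/2, 1 and 2 gives sectors whose angles
   have tangent at most 1/2. *)
Definition cls (p : C) : bool * bool * bool * bool * bool * bool :=
  (`[< 0 <= p.1 >], `[< 0 <= p.2 >], `[< Rabs p.2 <= Rabs p.1 >],
   `[< 2 * Rabs p.2 <= Rabs p.1 >], `[< 2 * Rabs p.1 <= Rabs p.2 >],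
   `[< p = 0%C >]).

Definition dot (p q : C) : R := p.1 * q.1 + p.2 * q.2.
Definition cross (p q : C) : R := p.1 * q.2 - p.2 * q.1.

Lemma asbool_le_eq (a b c d : R) :
  `[< a <= b >] = `[< c <= d >] -> a <= b /\ c <= d \/ b < a /\ d < c.
Proof.
move=> e; have h := asbool_eq_equiv e; case: (Rle_dec a b) => hab; first by left; tauto.
by right; split; apply: Rnot_le_lt; tauto.
Qed.

Lemma cls_cross p q : cls p = cls q -> 2 * Rabs (cross p q) <= dot p q.
Proof.
case: p q => [x y] [x' y'] [] /asbool_le_eq h1 /asbool_le_eq h2 /asbool_le_eq h3
  /asbool_le_eq h4 /asbool_le_eq h5 _.
rewrite /cross /dot /=.
suff: - (x * x' + y * y') <= 2 * (x * y' - y * x') <= x * x' + y * y'.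
  by rewrite /Rabs; case: Rcase_abs => ?; lra.
move: h3 h4 h5.
case: h1 => [[h1 h1']|[h1 h1']]; case: h2 => [[h2 h2']|[h2 h2']] /=;
  rewrite ?(Rabs_pos_eq _ h1) ?(Rabs_pos_eq _ h1') ?(Rabs_pos_eq _ h2)
    ?(Rabs_pos_eq _ h2') ?(Rabs_left _ h1) ?(Rabs_left _ h1') ?(Rabs_left _ h2)
    ?(Rabs_left _ h2');
  move=> [[? ?]|[? ?]] [[? ?]|[? ?]] [[? ?]|[? ?]]; try (exfalso; lra); split; nra.
Qed.

Lemma Cmod_sqr p : Cmod p ^ 2 = p.1 ^ 2 + p.2 ^ 2.
Proof. by rewrite Cmod2_alt. Qed.

Lemma Cmod_le_sqr p r : 0 <= r -> Cmod p ^ 2 <= r ^ 2 -> Cmod p <= r.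
Proof. by move=> r0 h; have := Cmod_ge_0 p; nra. Qed.

Lemma Cmod_sub_sqr p q :
  Cmod (p - q) ^ 2 = Cmod p ^ 2 + Cmod q ^ 2 - 2 * dot p q.
Proof. by rewrite !Cmod_sqr /dot /=; ring. Qed.

Lemma dot_cross p q :
  dot p q ^ 2 + cross p q ^ 2 = (Cmod p * Cmod q) ^ 2.
Proof. by rewrite Rpow_mult_distr !Cmod_sqr /dot /cross; ring. Qed.

(** By Lagrange's identity [dot_cross], an angle of tangent at most 1/2 has cosine at least 2/sqrt
    5, which exceeds 7/8. *)
Lemma cls_dot p q : cls p = cls q ->
  0 <= dot p q /\ 4 * (Cmod p * Cmod q) ^ 2 <= 5 * dot p q ^ 2.
Proof.
move=> /cls_cross h; have h0 := Rabs_pos (cross p q); split; first by lra.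
by rewrite -dot_cross -(pow2_abs (cross p q)); nra.
Qed.

(** After squaring, a cosine of 7/8 is just enough in the extreme case |p| = |q|. The gain of |p|/2
    is what pays for the distortion by inversion in [inv_cone_sub]. *)
Lemma cls_sub p q : cls p = cls q -> Cmod p <= Cmod q ->
  Cmod (p - q) <= Cmod q - Cmod p / 2.
Proof.
move=> /cls_dot [d0 d1] le_pq.
have p0 := Cmod_ge_0 p; have q0 := Cmod_ge_0 q.
apply: Cmod_le_sqr; first by lra.
rewrite Cmod_sub_sqr.
have h : 7 / 8 * (Cmod p * Cmod q) <= dot p q.
  have pq0 : 0 <= Cmod p * Cmod q by nra.
  move: (Cmod p * Cmod q) pq0 d1 => t; nra.
by nra.
Qed.

Lemma cls_sub_near p q : cls p = cls q ->
  Cmod p ^ 2 <= Cmod q ^ 2 <= 2 * Cmod p ^ 2 -> Cmod (p - q) <= Cmod q / 2.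
Proof.
move=> /cls_dot [d0 d1] [le_pq le_qp].
have p0 := Cmod_ge_0 p; have q0 := Cmod_ge_0 q.
apply: Cmod_le_sqr; first by lra.
rewrite Cmod_sub_sqr.
rewrite Rpow_mult_distr in d1.
suff : Cmod p ^ 2 + 3 / 4 * Cmod q ^ 2 <= 2 * dot p q by nra.
have := pow2_ge_0 (Cmod p).
move: (Cmod p ^ 2) (Cmod q ^ 2) (dot p q) le_pq le_qp d0 d1 => x y d *.
(* As d^2 >= 4/5 x y, it suffices that (x + 3/4 y)^2 <= 16/5 x y. This is convex in y, and at the
   ends y = x and y = 2x it reads 49/16 <= 16/5 and 25/4 <= 32/5. *)
suff: (x + 3 / 4 * y) ^ 2 <= (2 * d) ^ 2 by nra.
by nra.
Qed.

(* The cone is centred at the image [1/a'] of the neighbour, not at [1/a]: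
   inverting [B(a, |a - a'|)] gives a disc with [1/a'] on its boundary. *)
Lemma inv_cone_sub (a a' w : C) : a <> 0%C -> a' <> 0%C ->
  Cmod (a - a') <= Cmod a / 2 ->
  cls (w - / a') = cls (/ a - / a') ->
  Cmod (w - / a') <= Cmod (/ a - / a') -> Cmod (/ w - a) <= Cmod (a - a').
Proof.
move=> a0 a'0 le_r /cls_sub h /[dup] le_w /h {}h.
have A0 := (Cmod_gt_0 a).1 a0; have A'0 := (Cmod_gt_0 a').1 a'0.
have e2 : Cmod (/ a - / a') = Cmod (a - a') * / Cmod a * / Cmod a'.
  rewrite -(Cmod_opp (a - a')) -!Cmod_inv // -!Cmod_mult.
  by congr Cmod; field.
have e3 : (w - / a' - (/ a - / a') = w - / a)%C by ring.
rewrite e3 in h.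
set v := / Cmod a'.
have v0 : 0 < v by apply: Rinv_0_lt_compat.
have hv : v <= Cmod w + Cmod (w - / a').
  rewrite /v -Cmod_inv // -(Cmod_opp (w - / a')).
  by apply: Rle_trans (Cmod_triangle _ _); apply: Req_le; congr Cmod; ring.
have hq : Cmod (/ a - / a') <= v / 2.
  rewrite e2 -/v.
  have : Cmod (a - a') * / Cmod a <= / 2.
    apply: (Rmult_le_reg_r (Cmod a)) => //; rewrite Rmult_assoc Rinv_l; lra.
  nra.
have W0 : 0 < Cmod w by lra.
have w0 : w <> 0%C by apply/Cmod_gt_0.
have -> : Cmod (/ w - a) = Cmod (w - / a) * Cmod a * / Cmod w.
  rewrite -(Cmod_opp (w - / a)) -Cmod_inv // -!Cmod_mult.
  by congr Cmod; field.
have -> : Cmod (a - a') = Cmod (/ a - / a') * Cmod a * / v.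
  by rewrite e2 /v; field; split; lra.
apply: (Rmult_le_reg_r (Cmod w * v)); first by nra.
replace (Cmod (w - / a) * Cmod a * / Cmod w * (Cmod w * v))
  with (Cmod a * (Cmod (w - / a) * v)) by (field; lra).
replace (Cmod (/ a - / a') * Cmod a * / v * (Cmod w * v))
  with (Cmod a * (Cmod (/ a - / a') * Cmod w)) by (field; lra).
apply: Rmult_le_compat_l; first by lra.
(* Put t = |w - 1/a'| and q = |1/a - 1/a'|. Since |w - 1/a| <= q - t/2 and |w| >= v - t, it suffices
   that (q - t/2) v <= q (v - t), which follows from q <= v/2. *)
have := Cmod_ge_0 (w - / a'); nra.
Qed.

(** * Counting in finite sequences *)

Lemma size_le_card (T : eqType) (F : finType) (f : T -> F) (s : seq T) :
  uniq s -> {in s &, injective f} -> (size s <= #|F|)%N.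
Proof.
move=> us fI; rewrite -(size_map f) -(card_uniqP _) ?max_card //.
by rewrite map_inj_in_uniq.
Qed.

Lemma sum_count_exchange (T U : Type) (P : T -> U -> bool) (s : seq T) (t : seq U) :
  (\sum_(x <- s) count (P x) t = \sum_(y <- t) count (P ^~ y) s)%N.
Proof.
under eq_bigr do rewrite -sum1_count big_mkcond.
rewrite exchange_big; apply: eq_bigr => y _.
by rewrite -big_mkcond sum1_count.
Qed.

Lemma sum_le_const (T : eqType) (s : seq T) (F : T -> nat) (k : nat) :
  {in s, forall x, (F x <= k)%N} -> (\sum_(x <- s) F x <= k * size s)%N.
Proof.
elim: s => [|x s IH] h; first by rewrite big_nil.
rewrite big_cons mulnS leq_add ?h ?mem_head // IH // => y ys.
by rewrite h // in_cons ys orbT.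
Qed.

Lemma size_le_fibres (T U : eqType) (f : T -> U) (s : seq T) (t : seq U) (k : nat) :
  {in s, forall x, f x \in t} ->
  {in t, forall y, (count (fun x => f x == y) s <= k)%N} ->
  (size s <= k * size t)%N.
Proof.
move=> fst hk.
apply: leq_trans (sum_le_const hk); rewrite -(sum_count_exchange (fun x y => f x == y)).
rewrite -sum1_size big_seq [X in (_ <= X)%N]big_seq; apply: leq_sum => x xs.
by rewrite -has_count; apply/hasP; exists (f x); rewrite ?fst.
Qed.

Lemma argmin_seq (T : eqType) (D : T -> R) (x0 : T) (s : seq T) : x0 \in s ->
  exists2 x, x \in s & {in s, forall y, D x <= D y}.
Proof.
elim: s x0 => // x s IH x0 _; case: s IH => [|x1 s] IH.
  by exists x; rewrite ?mem_head // => y; rewrite mem_seq1 => /eqP->; lra.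
have [y ys hy] := IH x1 (mem_head _ _).
case: (Rle_dec (D x) (D y)) => h.
  exists x; rewrite ?mem_head // => z; rewrite in_cons => /predU1P[->|/hy]; lra.
exists y; first by rewrite in_cons ys orbT.
by move=> z; rewrite in_cons => /predU1P[->|/hy]; lra.
Qed.

(** Markov's inequality with a factor 4: two conditions of this kind together still hold for at
    least half of the elements. *)
Lemma count_markov (T : Type) (s : seq T) (F : T -> nat) (k : nat) :
  (\sum_(x <- s) F x <= k)%N ->
  (4 * count (fun x => ~~ (F x * size s <= 4 * k)%N) s <= size s)%N.
Proof.
move=> hF; set bad := count _ _.
have h : (bad * (4 * k).+1 <= \sum_(x <- s) F x * size s)%N.
  rewrite /bad; move: (size s) => g; elim: s {hF bad} => [|x s IH]; first by rewrite big_nil.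
  rewrite big_cons /= mulnDl leq_add //.
  by case: (leqP (F x * g)%N (4 * k)%N) => /= h; rewrite ?mul0n ?mul1n.
rewrite -big_distrl /= in h.
have {}h : (bad * (4 * k).+1 <= k * size s)%N.
  by apply: leq_trans h _; rewrite leq_mul2r hF orbT.
rewrite leqNgt; apply/negP => hb.
have : ((size s).+1 * k <= 4 * bad * k)%N by rewrite leq_mul2r hb orbT.
nia.
Qed.

(** * Ranks within a cone and the overlap of discs *)

Definition near (u v s : C) : bool :=
  (cls (s - u) == cls (v - u)) && `[< Cmod (s - u) <= Cmod (v - u) >].

(** Up to ties, the position of [v] when the points of [S] in its sector at apex [u] are ordered by
    distance from [u]. *)
Notation rank S u v := (count (near u v) S).

Notation ncls := #|{: bool * bool * bool * bool * bool * bool}|.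

(** In each sector at [u], the point of [V] farthest from [u] has a rank that counts all points of
    [V] in that sector. *)
Lemma size_low_rank (S V : seq C) (u : C) (k g : nat) :
  uniq V -> {subset V <= S} -> {in V, forall v, (rank S u v * g <= k)%N} ->
  (size V * g <= ncls * k)%N.
Proof.
move=> uV VS hk.
have -> : size V = (\sum_(c : bool * bool * bool * bool * bool * bool)
                      count (fun v => cls (v - u) == c) V)%N.
  rewrite -(sum_count_exchange (fun v c => cls (v - u) == c)).
  rewrite -sum1_size; apply: eq_bigr => v _.
  rewrite (eq_count (a2 := pred1 (cls (v - u)))) => [|c]; last exact: eq_sym.
  by rewrite count_uniq_mem ?index_enum_uniq ?mem_index_enum.
rewrite big_distrl /= -sum_nat_const; apply: leq_sum => c _.
rewrite -size_filter; set W := [seq _ <- _ | _].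
case: (altP (W =P [::])) => [->//|]; rewrite -size_eq0 -lt0n -has_predT => /hasP[w0 w0W _].
have [w wW hw] := argmin_seq (fun v => - Cmod (v - u)) w0W.
have wV : w \in V by move: wW; rewrite mem_filter => /andP[].
apply: leq_trans (hk _ wV); rewrite leq_mul2r; apply/orP; right.
rewrite -size_filter uniq_leq_size ?filter_uniq // => x xW.
have := hw _ xW; move: xW wW; rewrite !mem_filter /near => /andP[/eqP-> xV] /andP[/eqP-> _] le_x.
by rewrite VS // eqxx andbT; apply/asboolP; lra.
Qed.

Definition covers (r : C -> R) (z a : C) : bool := `[< Cmod (z - a) <= r a >].

(** If two centres lay in one sector seen from [z], then by [cls_sub] the nearer one would fall
    inside the disc of the other, which contains no centre but its own. *)
Lemma overlap (G : seq C) (r : C -> R) (z : C) : uniq G ->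
  {in G &, forall a b, b != a -> r a <= Cmod (a - b)} ->
  (count (covers r z) G <= ncls)%N.
Proof.
move=> uG hr; rewrite -size_filter.
apply: (size_le_card (f := fun a => cls (a - z))); first by rewrite filter_uniq.
have key (a b : C) : a \in G -> b \in G -> Cmod (z - b) <= r b ->
    cls (a - z) = cls (b - z) -> Cmod (a - z) <= Cmod (b - z) -> a = b.
  move=> aG bG hb e le_ab; apply/eqP; apply/negPn/negP => ne.
  have h := cls_sub e le_ab; have h2 := hr _ _ bG aG ne.
  have e2 : (a - z - (b - z) = - (b - a))%C by ring.
  rewrite e2 Cmod_opp in h.
  have e3 : (z - b = - (b - z))%C by ring.
  rewrite e3 Cmod_opp in hb.
  have h0 := Cmod_ge_0 (a - z).
  (* Only the boundary case a = z survives the strict inequality; there the last component of [cls],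
     the test for 0, forces b = z as well. *)
  have /Cmod_eq_0 az : Cmod (a - z) = 0 by lra.
  case: e => _ _ _ _ _; rewrite az => e.
  have bz : (b - z)%C = 0%C.
    by have := asbool_eq_equiv e; tauto.
  have eab : a = (b - z - (a - z) + a)%C by rewrite bz az; ring.
  have eba : (b - z - (a - z) + a)%C = b by ring.
  by move/eqP: ne; apply; rewrite eab eba.
move=> a b; rewrite !mem_filter => /andP[/asboolP ha aG] /andP[/asboolP hb bG] e.
case: (Rle_dec (Cmod (a - z)) (Cmod (b - z))) => h; first exact: key.
by apply/esym/key => //; lra.
Qed.

(** [psi] carries the cone at [u a] back into the disc about [a], so by [overlap] each [s] is
    counted for at most [ncls] points [a]. *)
Lemma sum_rank (G S : seq C) (r : C -> R) (u v psi : C -> C) : uniq G ->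
  {in G &, forall a b, b != a -> r a <= Cmod (a - b)} ->
  (forall a s, a \in G -> near (u a) (v a) s -> Cmod (psi s - a) <= r a) ->
  (\sum_(a <- G) rank S (u a) (v a) <= ncls * size S)%N.
Proof.
move=> uG hr hpsi; rewrite (sum_count_exchange (fun a s => near (u a) (v a) s)).
apply: sum_le_const => s _; apply: leq_trans (overlap (psi s) uG hr).
rewrite -!size_filter; apply: uniq_leq_size; first by rewrite filter_uniq.
by move=> a; rewrite !mem_filter => /andP[h aG]; rewrite aG andbT; apply/asboolP/hpsi.
Qed.

Lemma pairs_low_rank (S : seq C) (k g : nat) : uniq S ->
  (size [seq p <- [seq (u, v) | u <- S, v <- S] | rank S p.1 p.2 * g <= k] * g
     <= ncls * k * size S)%N.
Proof.
move=> uS; rewrite size_filter -sum1_count big_mkcond big_allpairs /= big_distrl /=.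
apply: sum_le_const => u _; rewrite -big_mkcond sum1_count -size_filter.
apply: (@size_low_rank S _ u); first by rewrite filter_uniq.
  by move=> v; rewrite mem_filter => /andP[].
by move=> v; rewrite mem_filter => /andP[].
Qed.

(** * Points with a close neighbour *)

Lemma size_le2 (T : eqType) (s : seq T) : uniq s ->
  (forall x y z, x \in s -> y \in s -> z \in s -> x != y -> x != z -> y = z) ->
  (size s <= 2)%N.
Proof.
case: s => [|x [|y [|z s]]] // /and3P[]; rewrite !inE !negb_or.
move=> /and3P[xy xz _] /andP[yz _] _ h.
by move: yz; rewrite (h x y z) ?inE ?eqxx ?orbT.
Qed.

Lemma Csub_eq0 (a b : C) : (a - b)%C = 0%C -> a = b.
Proof. by move=> h; have -> : a = (a - b + b)%C by [ring]; rewrite h; ring. Qed.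

Lemma Cplus_cancel (s t t' : C) : (s + t = s + t')%C -> t = t'.
Proof. by move=> h; have -> : t = (s + t - s)%C by [ring]; rewrite h; ring. Qed.

(* [a - a'] and [1/a - 1/a'] determine [a a'], so [a] is one of the two roots of
   a quadratic polynomial. *)
Lemma two_solutions (a1 a2 a3 a1' a2' a3' : C) :
  a1 <> 0%C -> a2 <> 0%C -> a3 <> 0%C -> a1' <> 0%C -> a2' <> 0%C -> a3' <> 0%C ->
  a1 <> a1' -> a1 <> a2 -> a1 <> a3 ->
  (a2 - a2' = a1 - a1')%C -> (a3 - a3' = a1 - a1')%C ->
  (/ a2 - / a2' = / a1 - / a1')%C -> (/ a3 - / a3' = / a1 - / a1')%C -> a2 = a3.
Proof.
have key (a b a' b' : C) : a <> 0%C -> b <> 0%C -> a' <> 0%C -> b' <> 0%C ->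
    a <> a' -> a <> b -> (b - b' = a - a')%C -> (/ b - / b' = / a - / a')%C ->
    b = (- a')%C.
  move=> a0 b0 a'0 b'0 aa' ab d e.
  have d0 : (a - a')%C <> 0%C by move/Csub_eq0.
  have ab0 : (a - b)%C <> 0%C by move/Csub_eq0.
  have b'E : b' = (b - (a - a'))%C by rewrite -d; ring.
  have p : (b * b' = a * a')%C.
    have e1 : (/ b - / b' = - (b - b') * / (b * b'))%C by field.
    have e2 : (/ a - / a' = - (a - a') * / (a * a'))%C by field.
    rewrite e1 e2 d in e.
    have e3 : (/ (b * b') = / (a * a'))%C.
      have -> : (/ (b * b') = - / (a - a') * (- (a - a') * / (b * b')))%C by field.
      by rewrite e; field.
    have -> : (b * b' = / / (b * b'))%C by field.
    by rewrite e3; field.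
  rewrite b'E in p.
  (* Both [a] and [b] are roots of t (t - (a - a')) = a a', whose second root is -a'. *)
  have q : ((a - b) * (b + a') = 0)%C.
    have -> : ((a - b) * (b + a') = a * a' - b * (b - (a - a')))%C by ring.
    by rewrite p; ring.
  have -> : (b = / (a - b) * ((a - b) * (b + a')) - a')%C by field.
  by rewrite q; ring.
move=> *; rewrite (key a1 a2 a1' a2') // (key a1 a3 a1' a3') //.
Qed.

(** Double counting of the triples [W] for which both pairs of sums have low rank. [B1] and [B2] are
    separate so that one argument serves both claims: they become A and 1/A, or 1/A and A. *)
Lemma neighbour_bound (G B1 B2 S1 S2 : seq C) (nn : C -> C) :
  uniq G -> uniq B1 -> uniq B2 -> uniq S1 -> uniq S2 ->
  {in G, forall a : C, [/\ a <> 0%C, nn a <> 0%C, a <> nn a &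
                       Cmod (a - nn a) <= Cmod a / 2]} ->
  {in G &, forall a b : C, b != a -> Cmod (a - nn a) <= Cmod (a - b)} ->
  {in G & B1, forall a b : C, (a + b)%C \in S1 /\ (nn a + b)%C \in S1} ->
  {in G & B2, forall a c : C, (/ a + c)%C \in S2 /\ (/ nn a + c)%C \in S2} ->
  (size B1 * size B2 * size G ^ 3
     <= 64 * ncls ^ 4 * (size S1 ^ 2 * size S2 ^ 2))%N.
Proof.
move=> uG uB1 uB2 uS1 uS2 hG hnn hS1 hS2.
set g := size G.
(* The threshold is four times the bound of [sum_rank], so by [count_markov] each of the two
   conditions fails for at most a quarter of [G]. *)
pose good S u v := (rank S u v * g <= 4 * (ncls * size S))%N.
pose low S := [seq p <- [seq (u, v) | u <- S, v <- S] | good S p.1 p.2].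
pose P (x : C * C * C) := good S1 (x.2 + x.1.1)%C (nn x.2 + x.1.1)%C
                          && good S2 (/ nn x.2 + x.1.2)%C (/ x.2 + x.1.2)%C.
pose W := [seq x <- [seq (bc, a) | bc <- [seq (b, c) | b <- B1, c <- B2], a <- G] | P x].
have W_ge : (size B1 * size B2 * g <= 2 * size W)%N.
  rewrite /W size_filter -sum1_count big_mkcond big_allpairs /=.
  rewrite -(size_allpairs pair) -sum1_size big_distrl big_distrr /=.
  apply: leq_sum => -[b c] _; rewrite -big_mkcond sum1_count mul1n.
  have m1 : (4 * count (fun a => ~~ good S1 (a + b)%C (nn a + b)%C) G <= g)%N.
    apply: count_markov; apply: (@sum_rank _ _ (fun a => Cmod (a - nn a)) _ _ (fun s => (s - b)%C)) => // a s aG /andP[_ /asboolP].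
    have -> : (nn a + b - (a + b) = - (a - nn a))%C by ring.
    rewrite Cmod_opp; have -> : (s - b - a = s - (a + b))%C by ring.
    by [].
  have m2 : (4 * count (fun a => ~~ good S2 (/ nn a + c)%C (/ a + c)%C) G <= g)%N.
    apply: count_markov; apply: (@sum_rank _ _ (fun a => Cmod (a - nn a)) _ _ (fun s => (/ (s - c))%C)) => // a s aG.
    have [a0 a'0 _ le_r] := hG _ aG.
    have e1 : (s - (/ nn a + c) = (s - c) - / nn a)%C by ring.
    have e2 : (/ a + c - (/ nn a + c) = / a - / nn a)%C by ring.
    rewrite /near e1 e2 => /andP[/eqP h1 /asboolP h2].
    exact: inv_cone_sub.
  pose p1 a := good S1 (a + b)%C (nn a + b)%C.
  pose p2 a := good S2 (/ nn a + c)%C (/ a + c)%C.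
  have : (g <= count (fun a => p1 a && p2 a) G
               + (count (fun a => ~~ p1 a) G + count (fun a => ~~ p2 a) G))%N.
    rewrite -count_predUI addnA; apply: leq_trans (leq_addr _ _).
    rewrite /g -(count_predC (fun a => p1 a && p2 a)) leq_add2l.
    by apply: sub_count => a /=; rewrite negb_and.
  rewrite -/p1 -/p2 in m1 m2; move: m1 m2.
  change (count (fun a => P (b, c, a)) G) with (count (fun a => p1 a && p2 a) G).
  move: (count _ G) (count (fun a => ~~ p1 a) G) (count _ G) => x y z; lia.
have W_le : (size W <= 2 * (size (low S1) * size (low S2)))%N.
  pose phi (x : C * C * C) := (((x.2 + x.1.1)%C, (nn x.2 + x.1.1)%C),
                               ((/ nn x.2 + x.1.2)%C, (/ x.2 + x.1.2)%C)).
  rewrite -(size_allpairs pair); apply: (size_le_fibres (f := phi)).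
    move=> [[b c] a]; rewrite mem_filter => /andP[+ xin].
    move: xin => /allpairsP[[bc a1] /= [/allpairsP[[b1 c1] /= [bB cB ->]] aG [-> -> ->]]] /andP[h1 h2].
    have [u1 v1] := hS1 _ _ aG bB; have [u2 v2] := hS2 _ _ aG cB.
    by apply: allpairs_f; rewrite mem_filter allpairs_f ?andbT.
  (* Within a fibre of [phi], the point a determines b and c, and [two_solutions] leaves at most two
     values of a. *)
  move=> y _; rewrite -size_filter; apply: size_le2.
    rewrite !filter_uniq //; apply: allpairs_uniq => //; first by apply: allpairs_uniq => // -[? ?] [? ?].
    by move=> [? ?] [? ?].
  have inW x : x \in [seq x <- W | phi x == y] -> x.2 \in G /\ phi x = y.
    rewrite !mem_filter => /andP[/eqP-> /andP[_ /allpairsP[[bc a] [_ aG ->]]]].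
    by split.
  have inj x z : phi x = y -> phi z = y -> x.2 = z.2 -> x = z.
    case: x z => [[b c] a] [[b' c'] a'] <- e aa'.
    have {}aa' : a = a' := aa'; rewrite -{}aa' in e *.
    have h1 : (a + b')%C = (a + b)%C := congr1 (fun p => p.1.1) e.
    have h2 : (/ a + c')%C = (/ a + c)%C := congr1 (fun p => p.2.2) e.
    by rewrite (Cplus_cancel h1) (Cplus_cancel h2).
  move=> x1 x2 x3 /inW[G1 e1] /inW[G2 e2] /inW[G3 e3] /eqP n12 /eqP n13.
  apply: (inj _ _ e2 e3).
  have [n1 n1' d1 _] := hG _ G1; have [n2 n2' _ _] := hG _ G2.
  have [n3 n3' _ _] := hG _ G3.
  have diff (s s' t : C) : (s - s' = (s + t) - (s' + t))%C by ring.
  have ex x : phi x = phi x1 -> [/\ (x.2 + x.1.1 = x1.2 + x1.1.1)%C,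
      (nn x.2 + x.1.1 = nn x1.2 + x1.1.1)%C, (/ x.2 + x.1.2 = / x1.2 + x1.1.2)%C &
      (/ nn x.2 + x.1.2 = / nn x1.2 + x1.1.2)%C].
    by move=> e; split; [exact: (congr1 (fun p : C * C * (C * C) => p.1.1) e)
      | exact: (congr1 (fun p : C * C * (C * C) => p.1.2) e)
      | exact: (congr1 (fun p : C * C * (C * C) => p.2.2) e)
      | exact: (congr1 (fun p : C * C * (C * C) => p.2.1) e)].
  have [|f1 f2 f3 f4] := ex x2; first by rewrite e2.
  have [|f5 f6 f7 f8] := ex x3; first by rewrite e3.
  apply: (two_solutions n1 n2 n3 n1' n2' n3' d1).
  - by move=> e; apply: n12; exact: inj e.
  - by move=> e; apply: n13; exact: inj e.
  - by rewrite (diff _ _ x2.1.1) f1 f2 -diff.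
  - by rewrite (diff _ _ x3.1.1) f5 f6 -diff.
  - by rewrite (diff _ _ x2.1.2) f3 f4 -diff.
  - by rewrite (diff _ _ x3.1.2) f7 f8 -diff.
have low1 := pairs_low_rank (4 * (ncls * size S1)) g uS1.
have low2 := pairs_low_rank (4 * (ncls * size S2)) g uS2.
move: low1 low2; rewrite -/(low S1) -/(low S2).
move: (size (low S1)) (size (low S2)) W_le => q1 q2 W_le low1 low2.
(* Here |B1| |B2| g <= 2 |W| <= 4 q1 q2, and each qi g is at most 4 [ncls]^2 |Si|^2; hence the
   factor 64 [ncls]^4. *)
have {W_ge W_le} h : (size B1 * size B2 * g <= 4 * (q1 * q2))%N.
  by apply: leq_trans W_ge _; rewrite (_ : 4 = 2 * 2)%N // -mulnA leq_mul2l W_le.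
have -> : (size B1 * size B2 * g ^ 3 = size B1 * size B2 * g * (g * g))%N.
  by rewrite !expnS expn0; lia.
apply: leq_trans (leq_mul h (leqnn _)) _.
have -> : (4 * (q1 * q2) * (g * g) = 4 * ((q1 * g) * (q2 * g)))%N by lia.
apply: leq_trans (leq_mul (leqnn 4) (leq_mul low1 low2)) _.
move: ncls (size S1) (size S2) => k m1 m2.
apply: eq_leq; rewrite !expnS !expn0; lia.
Qed.

(** * Sums of sets with few points in every annulus *)

Definition in_annulus (rho : R) (a : C) : bool := `[< rho <= Cmod a <= 4 * rho >].

Notation nannulus :=
  #|{: bool * bool * bool * bool * bool * bool * (bool * bool * bool)}|.

(** The thresholds 2, 4 and 8 for |a|^2 / rho^2 cut the annulus into four rings. Two points in the
    same ring and sector would contradict isolation by [cls_sub_near]. *)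
Lemma count_annulus (L : seq C) (rho : R) : uniq L ->
  {in L &, forall a b : C, b != a -> Cmod a / 2 < Cmod (a - b)} ->
  (count (in_annulus rho) L <= nannulus)%N.
Proof.
move=> uL hL; rewrite -size_filter.
pose bin k a := `[< k * rho ^ 2 <= Cmod a ^ 2 >].
apply: (size_le_card (f := fun a => (cls a, (bin 2 a, bin 4 a, bin 8 a)))).
  by rewrite filter_uniq.
have key (p q : C) : p \in L -> q \in L -> rho <= Cmod p -> Cmod q <= 4 * rho ->
    cls p = cls q -> bin 2 p = bin 2 q -> bin 4 p = bin 4 q -> bin 8 p = bin 8 q ->
    Cmod p <= Cmod q -> p = q.
  move=> pL qL hp hq e /asbool_le_eq b2 /asbool_le_eq b4 /asbool_le_eq b8 le_pq.
  apply/eqP; apply/negPn/negP => ne; have := hL _ _ qL pL ne.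
  have p0 := Cmod_ge_0 p; have q0 := Cmod_ge_0 q.
  suff /(cls_sub_near e) : Cmod p ^ 2 <= Cmod q ^ 2 <= 2 * Cmod p ^ 2.
    have -> : (p - q = - (q - p))%C by ring.
    rewrite Cmod_opp; lra.
  split; first by nra.
  have : rho ^ 2 <= Cmod p ^ 2 by nra.
  have : Cmod q ^ 2 <= 16 * rho ^ 2 by nra.
  lra.
move=> p q; rewrite !mem_filter => /andP[/asboolP hp pL] /andP[/asboolP hq qL].
move=> e; have e1 : cls p = cls q := congr1 fst e.
have e2 : bin 2 p = bin 2 q := congr1 (fun x => x.2.1.1) e.
have e4 : bin 4 p = bin 4 q := congr1 (fun x => x.2.1.2) e.
have e8 : bin 8 p = bin 8 q := congr1 (fun x => x.2.2) e.
case: (Rle_dec (Cmod p) (Cmod q)) => h; first by apply: key => //; lra.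
by apply/esym/key => //; lra.
Qed.

(** Inversion exchanges the annuli of inner radii rho and 1/(4 rho). *)
Lemma count_annulus_inv (L : seq C) (k : nat) : {in L, forall a : C, a <> 0%C} ->
  (forall rho, count (in_annulus rho) L <= k)%N ->
  forall rho, (count (in_annulus rho) [seq (/ a)%C | a <- L] <= k)%N.
Proof.
move=> L0 hk rho; rewrite count_map; apply: leq_trans (hk (/ (4 * rho))).
rewrite -!size_filter -(size_map id); rewrite map_id.
have -> : [seq a <- L | preim Complex.Cinv (in_annulus rho) a]
  = [seq a <- [seq a <- L | preim Complex.Cinv (in_annulus rho) a] | in_annulus (/ (4 * rho)) a].
  apply/esym/all_filterP/allP => a; rewrite mem_filter => /andP[/asboolP + aL].
  have a0 := L0 _ aL; have A0 := (Cmod_gt_0 a).1 a0.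
  rewrite Cmod_inv // => -[h1 h2].
  have v0 := Rinv_0_lt_compat _ A0.
  have r0 : 0 < rho by lra.
  have hi : Cmod a * / Cmod a = 1 by field; lra.
  have hr : 4 * (rho * / (4 * rho)) = 1 by field; lra.
  have r1 : 0 < / (4 * rho) by apply: Rinv_0_lt_compat; lra.
  apply/asboolP; move: (/ Cmod a) (/ (4 * rho)) v0 hi hr r1 h1 h2 => v t *.
  by split; nra.
by rewrite -filter_predI !size_filter; apply: sub_count => a /andP[].
Qed.

Definition small (x y : C) : bool := `[< Cmod y <= Cmod x / 2 >].

(* If [|y| <= |x| / 2] then [x] lies in the annulus of radii [2/3 |x + y|] and
   [8/3 |x + y|]. *)
Lemma sum_small (X Y S : seq C) (k : nat) : uniq X -> uniq Y ->
  {in X & Y, forall x y : C, (x + y)%C \in S} ->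
  (forall rho, count (in_annulus rho) X <= k)%N ->
  (\sum_(x <- X) count (small x) Y <= k * size S)%N.
Proof.
move=> uX uY hS hk.
pose W := [seq p <- [seq (x, y) | x <- X, y <- Y] | small p.1 p.2].
have -> : (\sum_(x <- X) count (small x) Y = size W)%N.
  rewrite /W size_filter -[RHS]sum1_count [RHS]big_mkcond [RHS]big_allpairs /=.
  by apply: eq_bigr => x _; rewrite -big_mkcond sum1_count.
have mW x y : (x, y) \in W -> [/\ x \in X, y \in Y & Cmod y <= Cmod x / 2].
  rewrite mem_filter => /andP[/asboolP h /allpairsP[[x1 y1] [h1 h2 [e1 e2]]]].
  by rewrite e1 e2 in h *.
apply: (size_le_fibres (f := fun p => (p.1 + p.2)%C)).
  by move=> [x y] /mW[xX yY _]; exact: hS.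
move=> s _; apply: leq_trans (hk (2 / 3 * Cmod s)); rewrite -!size_filter.
rewrite -(size_map fst); apply: uniq_leq_size.
  rewrite map_inj_in_uniq.
    rewrite !filter_uniq //; apply: allpairs_uniq => //.
    by move=> [? ?] [? ?].
  move=> [x y] [x' y']; rewrite !mem_filter => /andP[/eqP /= e1 _] /andP[/eqP /= e2 _] ex.
  rewrite -{}ex in e2 *; congr pair; apply: (@Cplus_cancel x).
  by rewrite e1 e2.
move=> x /mapP[[x1 y] + /= ->]; rewrite mem_filter => /andP[/eqP /= e /mW[xX _ h]].
rewrite mem_filter xX andbT; apply/asboolP.
have h1 := Cmod_triangle x1 y; rewrite e in h1.
have h2 := Cmod_triangle s (- y)%C; rewrite Cmod_opp -e in h2.
have e3 : (x1 + y + - y)%C = x1 by ring.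
rewrite e3 e in h2; split; lra.
Qed.

(** For each pair, y is small against x, or x against y, or |y| lies between |x|/2 and 2|x|.
    [sum_small] counts the first two kinds, and a single annulus of ratio 4 the third. *)
Lemma sumset_lacunary (X Y S : seq C) (k : nat) : uniq X -> uniq Y ->
  {in X & Y, forall x y : C, (x + y)%C \in S} ->
  (forall rho, count (in_annulus rho) X <= k)%N ->
  (forall rho, count (in_annulus rho) Y <= k)%N ->
  (size X * size Y <= 2 * k * size S + k * size X)%N.
Proof.
move=> uX uY hS hX hY.
have h1 := sum_small uX uY hS hX.
have h2 : (\sum_(y <- Y) count (small y) X <= k * size S)%N.
  by apply: sum_small => // y x yY xX; rewrite Cplus_comm; apply: hS.
rewrite (sum_count_exchange small) in h2.
have h3 : (\sum_(x <- X) count (in_annulus (Cmod x / 2)) Y <= k * size X)%N.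
  by apply: sum_le_const.
have -> : (2 * k * size S + k * size X = k * size S + k * size S + k * size X)%N by lia.
apply: leq_trans (leq_add (leq_add h1 h2) h3).
rewrite -!big_split -sum1_size big_distrl /=; apply: leq_sum => x _.
rewrite mul1n -!size_filter -!size_cat uniq_leq_size // => y yY.
rewrite !mem_cat !mem_filter yY !andbT -orbA /small /in_annulus.
case: asboolP => //= n1; case: asboolP => //= n2.
by apply/asboolP; lra.
Qed.

(** * The dichotomy and the combined bound *)

Lemma Cinv_inj (a b : C) : a <> 0%C -> b <> 0%C -> (/ a = / b)%C -> a = b.
Proof.
move=> a0 b0 e; have -> : a = (a * (b * / b))%C by field.
by rewrite -e; field.
Qed.

Lemma neighbour_dichotomy (A : seq C) : uniq A ->
  exists (G L : seq C) (nn : C -> C),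
    [/\ size A = (size G + size L)%N, uniq G /\ uniq L,
        {subset G <= A} /\ {subset L <= A},
        {in G, forall a : C, [/\ nn a \in A, a <> nn a, Cmod (a - nn a) <= Cmod a / 2
          & {in A, forall b : C, b != a -> Cmod (a - nn a) <= Cmod (a - b)}]} &
        {in L & A, forall a b : C, b != a -> Cmod a / 2 < Cmod (a - b)}].
Proof.
move=> uA.
pose isG (a : C) := `[< exists2 b : C, b \in A & b != a /\ Cmod (a - b) <= Cmod a / 2 >].
have /choice[nn hnn] : forall a : C, exists c : C, a \in [seq a <- A | isG a] ->
    [/\ c \in A, a <> c, Cmod (a - c) <= Cmod a / 2
      & {in A, forall b : C, b != a -> Cmod (a - c) <= Cmod (a - b)}].
  (* The value 0 is a default outside the points with a close neighbour. *)
  move=> a; case: (boolP (a \in _)); last by exists 0%C.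
  rewrite mem_filter => /andP[/asboolP[b bA [ne_b le_b]] aA].
  have [|c] := argmin_seq (fun c => Cmod (a - c)) (x0 := b) (s := [seq b <- A | b != a]).
    by rewrite mem_filter ne_b.
  rewrite mem_filter => /andP[/eqP ne_c cA] hc; exists c => _; split=> //.
  - by move/esym.
  - by apply: Rle_trans le_b; apply: hc; rewrite mem_filter ne_b.
  - by move=> d dA ne_d; apply: hc; rewrite mem_filter ne_d.
exists [seq a <- A | isG a], [seq a <- A | ~~ isG a], nn; split=> //.
- by rewrite !size_filter -(count_predC isG).
- by rewrite !filter_uniq.
- by split=> a; rewrite mem_filter => /andP[].
- move=> a b; rewrite mem_filter => /andP[/asboolP h aA] bA ne.
  by apply: Rnot_le_lt => le_b; apply: h; exists b.
Qed.

(* [f] is the identity or the inversion; it makes [S1] contain [A + A] or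
   [A + 1/A]. *)
Lemma sumset_bound (A B1 B2 S1 S2 : seq C) (f : C -> C) (M : nat) :
  uniq A -> {in A, forall a : C, a <> 0%C} -> uniq B1 -> uniq B2 -> uniq S1 -> uniq S2 ->
  size B1 = size A -> size B2 = size A -> (size S1 <= M)%N -> (size S2 <= M)%N ->
  {in A & B1, forall a b : C, (a + b)%C \in S1} ->
  {in A & B2, forall a b : C, (/ a + b)%C \in S2} ->
  f = id \/ f = Complex.Cinv -> {in A &, forall a b : C, (a + f b)%C \in S1} ->
  (size A ^ 5 <= (8 * (64 * ncls ^ 4) + (12 * nannulus) ^ 4) * M ^ 4)%N.
Proof.
move=> uA A0 uB1 uB2 uS1 uS2 sB1 sB2 M1 M2 hS1 hS2 hf hSf.
have [G [L [nn [sA [uG uL] [GA LA] hG hL]]]] := neighbour_dichotomy uA.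
have [le_LG|lt_GL] := leqP (size L) (size G).
  have /= h := @neighbour_bound G B1 B2 S1 S2 nn uG uB1 uB2 uS1 uS2.
  have {}h : (size A * size A * size G ^ 3 <= 64 * ncls ^ 4 * M ^ 4)%N.
    rewrite -{1}sB1 -sB2; apply: leq_trans (h _ _ _ _) _.
    - by move=> a aG; have [? ? ? ?] := hG _ aG; split=> //; apply: A0 => //; apply: GA.
    - by move=> a b aG bG; have [_ _ _ h'] := hG _ aG; apply/h'/GA.
    - by move=> a b aG bB; have [nA _ _ _] := hG _ aG; split; apply: hS1 => //; apply: GA.
    - by move=> a b aG bB; have [nA _ _ _] := hG _ aG; split; apply: hS2 => //; apply: GA.
    have -> : (M ^ 4 = M ^ 2 * M ^ 2)%N by rewrite -expnD.
    by rewrite leq_mul // leq_mul ?leq_sqr.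
  have hA : (size A <= 2 * size G)%N by lia.
  (* Each case uses one summand of the constant; here the 8 is 2^3, from |A| <= 2 |G|. *)
  rewrite mulnDl; apply: leq_trans (leq_addr _ _).
  rewrite -mulnA.
  apply: leq_trans (leq_mul (leqnn 8) h).
  rewrite (_ : 8 = 2 ^ 3)%N // mulnCA -expnMn (_ : size A ^ 5 = size A * size A * size A ^ 3)%N.
    by rewrite leq_mul2l leq_exp2r // hA orbT.
  by rewrite !expnS expn0; lia.
have uY : uniq [seq f a | a <- L].
  rewrite map_inj_in_uniq // => a b /LA aA /LA bA; case: hf => -> // e.
  by apply: Cinv_inj e; exact: A0.
have hk rho : (count (in_annulus rho) L <= nannulus)%N.
  by apply: count_annulus => // a b aL /LA bA; exact: hL.
have hk' rho : (count (in_annulus rho) [seq f a | a <- L] <= nannulus)%N.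
  case: hf => ->; first by rewrite map_id.
  by apply: count_annulus_inv => // a /LA; exact: A0.
have h := sumset_lacunary (S := S1) uL uY _ hk hk'.
rewrite size_map in h.
have {}h : (size L * size L <= 2 * nannulus * size S1 + nannulus * size L)%N.
  by apply: h => a b /LA aA /mapP[c /LA cA ->]; exact: hSf.
(* A translate of [L] lies in [S1]. This absorbs the linear term, so |L|^2 <= 3 [nannulus] M, and
   |A| <= 2 |L| turns 3 into 12. *)
have hLS : (size L <= size S1)%N.
  case: (L) uL LA => // a0 L' uL' LA.
  rewrite -(size_map (fun a => (f a0 + a)%C)) uniq_leq_size //.
    by rewrite map_inj_uniq // => a b; exact: Cplus_cancel.
  by move=> _ /mapP[a /LA aA ->]; rewrite Cplus_comm hSf // LA ?mem_head.
have {}h : (size A ^ 2 <= 12 * nannulus * M)%N.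
  have : (size A <= 2 * size L)%N by lia.
  move: (size A) (size L) (size S1) (nannulus) M1 hLS h => n l s k.
  rewrite !expnS expn0; nia.
rewrite mulnDl; apply: leq_trans (leq_addl _ _).
(* The quadratic bound is stronger than required: |A|^5 <= |A|^8. *)
rewrite -expnMn; apply: leq_trans (_ : (size A ^ 2) ^ 4 <= _)%N.
  rewrite -expnM; case: (size A) => // n; exact: leq_pexp2l.
by rewrite leq_exp2r.
Qed.

(** * Transfer to the lists and real constants of the statement *)

Lemma NoDup_uniq (s : seq Cx) : NoDup s -> uniq s.
Proof.
elim=> //= x l nx _ ->; rewrite andbT; apply/negP => h; apply: nx.
elim: l h => //= y l IH; rewrite in_cons => /predU1P[->|/IH]; first by left.
by right.
Qed.

Lemma In_mem (x : Cx) (s : seq Cx) : In x s <-> x \in s.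
Proof.
elim: s => //= y s IH; rewrite in_cons; split.
  by case=> [->|/IH ->]; rewrite ?eqxx ?orbT.
by move=> /predU1P[->|/IH]; [left | right].
Qed.

Lemma CinvE (z : Cx) : Cinv z = (/ z)%C.
Proof. by rewrite /Cinv /Complex.Cinv /= !Rmult_1_r. Qed.

Lemma sumset_mem (X Y l : seq Cx) : (forall z, In z l <-> sumset X Y z) ->
  {in X & Y, forall x y : C, (x + y)%C \in l}.
Proof. by move=> h x y xX yY; apply/In_mem/h; exists x, y; rewrite !In_mem. Qed.

(** Passing to the successor of [k] makes the constant positive without evaluating [k]. *)
Lemma INR_bound (n m k : nat) : (n ^ 5 <= k * m ^ 4)%N ->
  / INR k.+1 * INR n ^ 5 <= INR m ^ 4.
Proof.
move=> h.
have pE i j : INR (i ^ j)%N = INR i ^ j.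
  by elim: j => // j IH; rewrite expnS mult_INR IH.
have k1 := lt_0_INR _ (Nat.lt_0_succ k).
apply: (Rmult_le_reg_l (INR k.+1)) => //; rewrite -Rmult_assoc Rinv_r; last by lra.
rewrite Rmult_1_l -!pE -mult_INR; apply/le_INR/leP.
by apply: leq_trans h _; rewrite multE leq_mul2r leqnSn orbT.
Qed.

(* Omega(n^{5/4}) with absolute constant c > 0:  c * n^5 <= m^4. *)
Theorem theorem7p2 :
  exists c : R, 0 < c /\
  forall (A : list Cx), NoDup A -> ~ In C0 A ->
    (forall m1 m2 : nat,
       card_is (sumset A A) m1 ->
       card_is (sumset (invset A) (invset A)) m2 ->
       c * INR (length A) ^ 5 <= INR (Nat.max m1 m2) ^ 4) /\
    (forall m3 : nat,
       card_is (sumset A (invset A)) m3 ->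
       c * INR (length A) ^ 5 <= INR m3 ^ 4).
Proof.
pose k := (8 * (64 * ncls ^ 4) + (12 * nannulus) ^ 4)%N.
exists (/ INR k.+1); split; first by apply/Rinv_0_lt_compat/lt_0_INR/Nat.lt_0_succ.
move=> A /NoDup_uniq uA nA0.
have A0 : {in A, forall a : C, a <> 0%C} by move=> a /In_mem aA e; apply: nA0; have <- : a = C0 := e.
have iA : invset A = [seq (/ a)%C | a <- A] by apply: eq_map => a; exact: CinvE.
have uI : uniq (invset A).
  rewrite iA map_inj_in_uniq // => a b aA bA e.
  by apply: Cinv_inj e; exact: A0.
have sI : size (invset A) = size A by exact: size_map.
have mI a : a \in A -> (/ a)%C \in invset A by rewrite iA => aA; exact: map_f.
split=> [m1 m2 [l1 [/NoDup_uniq u1 [/sumset_mem h1 <-]]] [l2 [/NoDup_uniq u2 [/sumset_mem h2 <-]]]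
        |m3 [l [/NoDup_uniq u [/sumset_mem h <-]]]]; apply: INR_bound => //.
  apply: (@sumset_bound A A (invset A) l1 l2 id) => //; try exact/leP/Nat.le_max_l.
  - exact/leP/Nat.le_max_r.
  - by move=> a b /mI aI; exact: h2.
  - by left.
apply: (@sumset_bound A (invset A) A l l Complex.Cinv) => //.
- by move=> a b /mI aI bA; rewrite Cplus_comm; exact: h.
- by right.
- by move=> a b aA /mI; exact: h.
Qed.
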